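(* Let $n\ge2$, $d\ge1$, $r\ge3$ with $n\ge d$ and $dr\equiv0\pmod n$; write $Q=Q_n(d,r)$ and $q=\lceil n/d\rceil$. (a) If $dr=n$: (i) for $3\le r\le6$, $\mathsf{bw}(Q)=2^{n-1}$; (ii) for $r\ge7$, $\dfrac{2^{n+1}}{5-8(r-1)/r^2}\le\mathsf{bw}(Q)\le 2^{n-1}$. (b) If $dr\ge 2n$: (i) if $d\mid n$ and ($r$ is even or $n\ge 2d$), then $\dfrac{2^{n+1}r^2}{r^2+8n^2/d^2}\le\mathsf{bw}(Q)\le 2^n\min\{dr/(2n),\,2\}$; (ii) if $r$ is odd and $n=d$, then $\dfrac{2^{n+1}r^2}{r^2+8}\le\mathsf{bw}(Q)\le 2^{n-1}\min\{r,5\}$; (iii) if $n\not\equiv0\pmod d$, then $2^n\min\Big\{\dfrac{dr}{4n+2d},\dfrac{2r^2}{r^2+8q^2}\Big\}\le\mathsf{bw}(Q)\le 2^n\min\{dr/(2n),\,2\}$.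
   Context: $\mathbb{Z}_2^n=\{0,1\}^n$ with coordinatewise addition mod 2; $e_i$ is the $i$-th standard basis vector, subscripts read modulo $n$. The recursive cube of rings $Q_n(d,r)$ is the simple graph on $\mathbb{Z}_2^n\times\mathbb{Z}_r$ in which $(a,x)$ is adjacent to $(a+e_{i+dx},x)$ for $1\le i\le d$ and to $(a,x\pm1)$. A bisection of a graph $X$ is a partition $\{U,\overline U\}$ of $V(X)$ with $||U|-|\overline U||\le1$; the bisection width $\mathsf{bw}(X)$ is the minimum, over all bisections, of the number of edges with one end in $U$ and the other in $\overline U$. *)

(* Defs.v *)
From HB Require Import structures.
From mathcomp Require Import all_boot all_order all_algebra.
Set Implicit Arguments. Unset Strict Implicit. Unset Printing Implicit Defensive.
Import Order.TTheory GRing.Theory Num.Theory.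

Definition rcr_vertex (n r : nat) : finType := ({ffun 'I_n -> bool} * 'I_r)%type.

(* (a,x) ~ (a + e_{i + d x}, x) for 1 <= i <= d (1-based subscripts mod n);
   with 0-based coordinates this flips coordinate (k + d*x) mod n, k < d.
   (a,x) ~ (a, x +- 1 mod r). *)
Definition rcr_adj (n d r : nat) (u v : rcr_vertex n r) : bool :=
  ((u.2 == v.2) &&
     [exists k : 'I_d, [forall j : 'I_n,
        v.1 j == (u.1 j (+) (val j == (k + d * u.2) %% n))]])
  || ((u.1 == v.1) &&
     ((val v.2 == (val u.2 + 1) %% r) || (val u.2 == (val v.2 + 1) %% r))).

Definition is_bisection (T : finType) (U : {set T}) : bool :=
  (#|U| <= #|~: U|.+1) && (#|~: U| <= #|U|.+1).

(* number of edges with one end in U and the other outside U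
   (each such edge counted once, via its end in U) *)
Definition cut_size (T : finType) (adj : rel T) (U : {set T}) : nat :=
  #|[set p : T * T | (p.1 \in U) && (p.2 \notin U) && adj p.1 p.2]|.

(* bisection width: minimum of cut_size over all bisections
   (#|T|^2 is an upper bound on any cut size, so it is a neutral start). *)
Definition bisection_width (T : finType) (adj : rel T) : nat :=
  \big[minn/(#|T| * #|T|)]_(U : {set T} | is_bisection U) cut_size adj U.

Definition Qbw (n d r : nat) : nat :=
  bisection_width (@rcr_adj n d r).

Definition ceil_div (n d : nat) : nat := (n + d.-1) %/ d.

(* Main.v *)
Require Import Defs.
From HB Require Import structures.
From mathcomp Require Import all_boot all_order all_algebra.
From mathcomp Require Import perm fingroup zify ring.
Import Order.TTheory GRing.Theory Num.Theory.
Set Implicit Arguments. Unset Strict Implicit. Unset Printing Implicit Defensive.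

(** Lower bounds.  For a vertex set U, the number A(g) of vertices of U that a
    permutation g of the vertices moves out of U is subadditive in g and
    invariant under inversion.  Write N = 2^n r.  To every displacement (c, y)
    associate a word g_{c,y} in the ring step S and the d flips E_k such that,
    from each fixed vertex u, the points g_{c,y} u exhaust the vertex set; for a
    bisection U, the sum of A(g_{c,y}) over all (c, y) is then
    |U| |~: U| = N^2 / 4.  Each word visits q consecutive ring positions that
    together carry all n bits, so subadditivity bounds the sum by
    2^n L A(S) + 2^(n-1) q r sum_k A(E_k), where L is the sum over y of the
    numbers of ring steps used.  As the cut has at least 2 A(S) + sum_k A(E_k)
    edges, 2^(n+1) r^2 <= max(4 L, 4 q r) * cut.  For q = ceil(n/d) one has
    4 L <= r^2 + 8 q^2, and for q = r (the case dr = n) one has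
    4 L <= 5 r^2 - 8 (r - 1).  In case (b)(iii) this already gives the second
    term of the minimum, since 4 q r <= r^2 + 8 q^2.

    Upper bounds.  Split by the value of one bit, or split the ring into two
    arcs, dividing the middle layer by the value of a bit when r is odd; if
    d < n that bit can be chosen among those not flipped in that layer. *)

Local Open Scope nat_scope.

(** * Points of a set moved out of it by a permutation *)

Section Crossing.

Variables (T : finType) (U : {set T}).
Implicit Types g h : {perm T}.

Definition crossing (g : {perm T}) : nat := \sum_(u in U) (g u \notin U).

Lemma crossing1 : crossing 1%g = 0.
Proof. by apply: big1 => u uU; rewrite perm1 uU. Qed.

Lemma crossingM g h : crossing (g * h)%g <= crossing g + crossing h.
Proof.
have -> : crossing h = \sum_(u | g u \in U) (h (g u) \notin U).
  by rewrite /crossing (reindex_inj (@perm_inj _ g)).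
rewrite /crossing big_mkcond [X in _ <= X + _]big_mkcond.
rewrite [X in _ <= _ + X]big_mkcond -big_split /=; apply: leq_sum => u _.
rewrite permM; case: (u \in U) => //.
by case: (g u \in U) => //=; case: (h (g u) \in U).
Qed.

(** As many points of [U] stay in [U] under [g] as under its inverse; the remaining points of [U]
    are those moved out. *)
Lemma crossingV g : crossing g^-1%g = crossing g.
Proof.
have compl h : \sum_(u in U) (h u \in U) + crossing h = #|U|.
  rewrite /crossing -big_split /= -sum1_card; apply: eq_bigr => u _.
  by case: (h u \in U).
have sym : \sum_(u in U) (g u \in U) = \sum_(u in U) (g^-1%g u \in U).
  rewrite big_mkcond [RHS]big_mkcond (reindex_inj (@perm_inj _ g^-1%g)) /=.
  apply: eq_bigr => u _; rewrite permKV.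
  by case: (u \in U); case: (g^-1%g u \in U).
by apply/eqP; rewrite -(eqn_add2l (\sum_(u in U) (g u \in U))) {1}sym !compl.
Qed.

Lemma crossingX g k : crossing (g ^+ k)%g <= k * crossing g.
Proof.
elim: k => [|k IHk]; first by rewrite expg0 crossing1.
by rewrite expgS mulSn (leq_trans (crossingM _ _)) // leq_add2l.
Qed.

Lemma crossing_prod (I : Type) (s : seq I) (P : pred I) (F : I -> {perm T}) :
  crossing (\prod_(i <- s | P i) F i)%g <= \sum_(i <- s | P i) crossing (F i).
Proof.
elim/big_rec2: _ => [|i k g _ IHk]; first by rewrite crossing1.
by rewrite (leq_trans (crossingM _ _)) // leq_add2l.
Qed.

(** For a fixed [u] the images [F w u] run through all points once, so exactly [#|~: U|] of them lie
    outside [U]. *)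
Lemma sum_crossing (W : finType) (F : W -> {perm T}) :
  (forall u, bijective (F^~ u)) ->
  \sum_w crossing (F w) = #|U| * #|~: U|.
Proof.
move=> bijF; rewrite exchange_big /= -sum_nat_const; apply: eq_bigr => u _.
rewrite cardE -sum1_size big_enum /= (reindex (F^~ u)) /=; last exact: onW_bij.
by rewrite [RHS]big_mkcond; apply: eq_bigr => w _; rewrite inE; case: (_ \in U).
Qed.

End Crossing.

(** * Bisections and the bisection width *)

Section Bisection.

Variables (T : finType) (adj : rel T).

Lemma bisection_width_le (U : {set T}) :
  is_bisection U -> bisection_width adj <= cut_size adj U.
Proof.
move=> bU; rewrite /bisection_width.
have := mem_index_enum U; elim: (index_enum _) => // V s IHs.
rewrite inE big_cons => /predU1P[<-|Us]; first by rewrite bU geq_minl.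
by case: ifP => _; rewrite ?geq_min IHs ?orbT.
Qed.

Lemma leq_bisection_width (U0 : {set T}) (K b : nat) :
  is_bisection U0 ->
  (forall U, is_bisection U -> b <= K * cut_size adj U) ->
  b <= K * bisection_width adj.
Proof.
move=> bU0 le_cut; apply: (big_ind (fun w => b <= K * w)) => //.
(* The default value of the minimum must satisfy the bound too; it dominates the cut of [U0]. *)
- rewrite (leq_trans (le_cut _ bU0)) // leq_mul2l -card_prod max_card.
  by rewrite orbT.
- by move=> x y lex ley; rewrite minnMr leq_min lex.
Qed.

Lemma half_is_bisection (U : {set T}) : #|U| = #|~: U| -> is_bisection U.
Proof. by rewrite /is_bisection => ->; rewrite leqnSn. Qed.

Lemma card_bisection_even (U : {set T}) :
  ~~ odd #|T| -> is_bisection U -> 4 * (#|U| * #|~: U|) = #|T| ^ 2.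
Proof.
rewrite /is_bisection -(cardsC U) => evT /andP[le1 le2].
have -> : #|~: U| = #|U|.
  by move: evT; rewrite oddD; lia.
by rewrite addnn -mul2n expnMn mulnn.
Qed.

Lemma swapped_card (U : {set T}) (phi : T -> T) :
  injective phi -> (forall u, (phi u \in U) = (u \notin U)) -> #|U| = #|~: U|.
Proof.
move=> phi_inj phiU.
have sub1 : phi @: U \subset ~: U.
  by apply/subsetP=> _ /imsetP[u uU ->]; rewrite inE phiU uU.
have sub2 : phi @: (~: U) \subset U.
  by apply/subsetP=> _ /imsetP[u uU ->]; rewrite phiU -in_setC.
apply/eqP; rewrite eqn_leq -{1}(card_imset _ phi_inj) subset_leq_card //=.
by rewrite -(card_imset _ phi_inj) subset_leq_card.
Qed.

End Bisection.

(** * Total number of ring steps in the words *)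

Lemma sum_minn_sub r : 4 * \sum_(y < r) minn y (r - y) <= r ^ 2.
Proof.
elim/ltn_ind: r => -[|[|r]] IHr; first by rewrite big_ord0.
  by rewrite big_ord1.
rewrite big_ord_recl big_ord_recr /= /bump /=.
have -> : \sum_(i < r) minn (1 + i) (r.+2 - (1 + i))
          = r + \sum_(i < r) minn i (r - i).
  rewrite -[X in _ = X + _](card_ord r) -sum1_card -big_split /=.
  by apply: eq_bigr => i _; have := ltn_ord i; lia.
have := IHr r (ltnW (ltnSn _)).
set h := \sum_(i < r) _.
by rewrite min0n; nia.
Qed.

Lemma sum_subn_ord m r : 2 * \sum_(y < r) (m - y) <= m * m.+1.
Proof.
(* The untouched tail of the triangular sum is kept so that induction on [r] closes. *)
suff : 2 * \sum_(y < r) (m - y) + (m - r) * (m - r).+1 <= m * m.+1 by lia.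
elim: r => [|r]; first by rewrite big_ord0; lia.
rewrite big_ord_recr /=; set h := \sum_(_ < _) _.
by case: (leqP m r) => ?; nia.
Qed.

(** Ring steps of a word of displacement y: m in the sweep, then |y - m| forward or |r - y - m|
    backward. Each absolute value is a sum of two truncated differences. *)
Definition ring_cost (m r y : nat) : nat :=
  m + minn ((y - m) + (m - y)) ((r - y - m) + (m - (r - y))).

Lemma sum_ring_cost m r :
  4 * \sum_(y < r) ring_cost m r y <= r ^ 2 + 8 * m ^ 2.
Proof.
set L := \sum_(y < r) _.
(* Uses m + |y - m| = y + 2 max(m - y, 0), and the same with r - y for y. The correction terms sum
   to at most m(m+1) + m(m-1) = 2m^2. *)
have le_cost : L <= \sum_(y < r) (minn y (r - y) + ((m - y) + (m - y))
                     + ((m.-1 - (r.-1 - y)) + (m.-1 - (r.-1 - y)))).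
  by apply: leq_sum => y _; have := ltn_ord y; rewrite /ring_cost; lia.
have rev_sum : \sum_(y < r) (m.-1 - (r.-1 - y)) = \sum_(y < r) (m.-1 - y).
  rewrite (reindex_inj rev_ord_inj) /=.
  by apply: eq_bigr => y _; have := ltn_ord y; lia.
move: le_cost; rewrite !big_split /= rev_sum.
have := sum_minn_sub r; have := sum_subn_ord m r; have := sum_subn_ord m.-1 r.
by case: (m) => [|k] /=; nia.
Qed.

(** When r = m + 1 and m > 0 the costs are explicit: m + 1 at y = 0, and m + min(y - 1, m - y) for 1
    <= y <= m. *)
Lemma sum_ring_cost_full m :
  4 * \sum_(y < m.+1) ring_cost m m.+1 y + 8 * m <= 5 * m.+1 ^ 2.
Proof.
case: m => [|m]; first by rewrite big_ord1.
rewrite big_ord_recl.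
have -> : \sum_(i < m.+1) ring_cost m.+1 m.+2 (lift ord0 i)
          = m.+1 ^ 2 + \sum_(i < m) minn i (m - i).
  rewrite big_ord_recr /=.
  have -> : \sum_(i < m) ring_cost m.+1 m.+2 (bump 0 i)
     = m * m.+1 + \sum_(i < m) minn i (m - i).
    rewrite -[X in X * _](card_ord m) -sum_nat_const -big_split /=.
    by apply: eq_bigr => i _; have := ltn_ord i; rewrite /ring_cost /bump; lia.
  have -> : ring_cost m.+1 m.+2 (bump 0 m) = m.+1 by rewrite /ring_cost /bump; lia.
  by rewrite addnAC -mulSnr mulnn.
have := sum_minn_sub m; rewrite /ring_cost /=; nia.
Qed.

(** Distinct listed neighbours of [u] outside [U] give distinct cut edges. *)
Lemma cut_size_ge (T : finType) (adj : rel T) (U : {set T}) (s : T -> seq T) :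
  (forall u, uniq (s u)) -> (forall u v, v \in s u -> adj u v) ->
  \sum_(u in U) \sum_(v <- s u) (v \notin U) <= cut_size adj U.
Proof.
move=> uniq_s adj_s.
have -> : cut_size adj U = \sum_(u in U) #|[set v | (v \notin U) && adj u v]|.
  rewrite /cut_size -sum1dep_card.
  under [RHS]eq_bigr => u _ do rewrite -sum1dep_card.
  by rewrite pair_big_dep /=; apply: eq_bigl => p; rewrite andbA.
apply: leq_sum => u _.
have -> : \sum_(v <- s u) (v \notin U) = size [seq v <- s u | v \notin U].
  by rewrite size_filter -sum1_count [RHS]big_mkcond; apply: eq_bigr => v _; case: ifP.
have /card_uniqP <- : uniq [seq v <- s u | v \notin U] by rewrite filter_uniq.
apply: subset_leq_card; apply/subsetP=> v.
by rewrite mem_filter inE => /andP[-> /adj_s].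
Qed.

(** * Flips, ring steps and sweeps as permutations of the vertices *)

Section RecursiveCubeOfRings.

Variables n d r : nat.
Hypotheses (n_gt0 : 0 < n) (le_dn : d <= n) (r_gt2 : 2 < r) (n_dvd : n %| d * r).

Notation bits := {ffun 'I_n -> bool}.
Notation V := (rcr_vertex n r).

(** Bit indices remain consistent when a walk wraps around the ring, because n divides dr. *)
Let modrE x : d * (x %% r) = d * x %[mod n].
Proof.
rewrite {2}(divn_eq x r) mulnDr mulnCA -modnDml.
by rewrite (eqP (dvdn_mull _ n_dvd)) add0n.
Qed.

(** Indices are read modulo n and counted with parity, so that composing flips is concatenating
    lists. *)
Definition flips (s : seq nat) (a : bits) : bits :=
  [ffun j : 'I_n => a j (+) odd (count (fun i => val j == i %% n) s)].

Lemma flips0 a : flips [::] a = a.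
Proof. by apply/ffunP=> j; rewrite ffunE addbF. Qed.

Lemma flips_cat s t a : flips (s ++ t) a = flips t (flips s a).
Proof. by apply/ffunP=> j; rewrite !ffunE count_cat oddD addbA. Qed.

Lemma flips1K i : involutive (flips [:: i]).
Proof. by move=> a; apply/ffunP=> j; rewrite !ffunE addbK. Qed.

Lemma flips1E i a j : flips [:: i] a j = a j (+) (val j == i %% n).
Proof. by rewrite ffunE /= addn0 oddb. Qed.

Lemma eq_flips (I : Type) (s : seq I) (f g : I -> nat) :
  (forall i, f i = g i %[mod n]) -> flips (map f s) =1 flips (map g s).
Proof.
move=> fg a; apply/ffunP=> j; rewrite !ffunE !count_map; congr (_ (+) odd _).
by apply: eq_count => i /=; rewrite fg.
Qed.

Lemma card_bit_false (i : 'I_n) : #|[set a : bits | ~~ a i]| * 2 = 2 ^ n.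
Proof.
have E := @swapped_card _ [set a : bits | ~~ a i] (flips [:: val i])
            (inv_inj (flips1K _)).
rewrite muln2 -addnn {2}E; last first.
  by move=> a; rewrite !inE flips1E modn_small ?ltn_ord // eqxx addbT.
by rewrite cardsC card_ffun card_bool card_ord.
Qed.

Definition flip_at (k : nat) (u : V) : V := (flips [:: k + d * u.2] u.1, u.2).

Lemma flip_atK k : involutive (flip_at k).
Proof. by case=> a x; rewrite /flip_at /= flips1K. Qed.

Definition flip_perm k : {perm V} := perm (inv_inj (flip_atK k)).

Definition ring_step (u : V) : V := (u.1, ordS u.2).

Lemma ring_step_inj : injective ring_step.
Proof.
move=> [a x] [b y] E.
by congr (_, _); [apply: (congr1 fst E) | apply: ordS_inj (congr1 snd E)].
Qed.

Definition ring_perm : {perm V} := perm ring_step_inj.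

Lemma flip_prodE s u :
  (\prod_(k <- s) flip_perm k)%g u = (flips [seq k + d * u.2 | k <- s] u.1, u.2).
Proof.
elim: s u => [|k s IHs] u; first by rewrite big_nil perm1 flips0; case: u.
by rewrite big_cons permM IHs permE /= -flips_cat.
Qed.

(** [c] is indexed relative to the start x of the walk: at position x + t, [flip_perm k] flips bit
    (k + d t) + d x. *)
Definition layer (c : pred nat) (t : nat) : {perm V} :=
  (\prod_(k <- [seq k <- iota 0 d | c (k + d * t)]) flip_perm k)%g.

(* From position x, traverses x, ..., x + t and flips there the bits i + d x
   (mod n) with i < d (t + 1) selected by c. *)
Fixpoint sweep (c : pred nat) (t : nat) : {perm V} :=
  if t is t'.+1 then (sweep c t' * ring_perm * layer c t)%g else layer c 0.

Lemma val_iter_ordS t (x : 'I_r) : val (iter t (@ordS r) x) = (x + t) %% r.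
Proof.
elim: t => [|t IHt]; first by rewrite addn0 modn_small.
by rewrite iterS /= IHt -addn1 modnDml addn1 addnS.
Qed.

Lemma sweepE c t u :
  sweep c t u = (flips [seq i + d * u.2 | i <- iota 0 (d * t.+1) & c i] u.1,
                 iter t (@ordS r) u.2).
Proof.
elim: t => [|t IHt] /=.
  rewrite /layer flip_prodE muln1.
  by under eq_filter => k do rewrite muln0 addn0.
rewrite !permM IHt permE /layer flip_prodE /= -iterS; congr (_, _).
rewrite [d * t.+2]mulnSr iotaD filter_cat map_cat flips_cat add0n.
have -> : iota (d * t.+1) d = [seq d * t.+1 + k | k <- iota 0 d].
  by rewrite -iotaDl addn0.
rewrite filter_map -map_comp.
rewrite (@eq_filter _ (preim _ _) (fun k => c (k + d * t.+1))); last first.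
  by move=> k /=; rewrite addnC.
apply: eq_flips => k; have /= -> := val_iter_ordS t.+1 u.2.
by rewrite -modnDmr modrE modnDmr mulnDr addnA addnAC [d * _ + k]addnC.
Qed.

(** Extension by false beyond n: a sweep with d(t+1) > n then still flips each bit at most once. *)
Definition ext (c : bits) : pred nat := fun i => oapp c false (insub i).

Lemma ext_ord c (i : 'I_n) : ext c i = c i.
Proof. by rewrite /ext valK. Qed.

Lemma ext_lt c i : ext c i -> i < n.
Proof. by rewrite /ext; case: insubP. Qed.

Lemma sum_ext i : 2 * \sum_(c : bits) ext c i <= 2 ^ n.
Proof.
case: (ltnP i n) => [lt_in | le_ni]; last first.
  rewrite big1 // => c _; apply/eqP; rewrite eqb0.
  by apply: contraL le_ni => /ext_lt; rewrite ltnNge.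
have := card_bit_false (Ordinal lt_in).
have : \sum_(c : bits) ext c i + #|[set a : bits | ~~ a (Ordinal lt_in)]| = 2 ^ n.
  rewrite -sum1_card [X in _ + X]big_mkcond -big_split /=.
  rewrite -[X in 2 ^ X]card_ord -card_bool -card_ffun -sum1_card.
  apply: eq_bigr => c _; rewrite inE -(ext_ord c (Ordinal lt_in)) /=.
  by case: (ext c i).
lia.
Qed.

(** The sweep passes all n bits and changes bit i + d x exactly when [c i] holds, so its result
    determines [c]. *)
Lemma sweep_inj m u : n <= d * m.+1 -> injective (fun c : bits => sweep (ext c) m u).
Proof.
move=> le_n c c'; rewrite !sweepE => -[E].
suff readE (b : bits) (i : 'I_n) (lt_j : (i + d * u.2) %% n < n) :
    flips [seq i + d * u.2 | i <- iota 0 (d * m.+1) & ext b i] u.1 (Ordinal lt_j)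
    = u.1 (Ordinal lt_j) (+) b i.
  apply/ffunP=> i; have lt_j : (i + d * u.2) %% n < n by rewrite ltn_mod.
  by apply: (@addbI (u.1 (Ordinal lt_j))); rewrite -!readE E.
rewrite ffunE; congr (_ (+) _); rewrite count_map count_filter /=.
rewrite (@eq_count _ _ (fun k : nat => b i && (k == val i))); last first.
  move=> k /=; rewrite andbC; case: (eqVneq k (val i)) => [-> | ne_ki].
    by rewrite eqxx !andbT ext_ord.
  rewrite andbF; apply/negP => /andP[/ext_lt lt_kn].
  rewrite eqn_modDr !modn_small // => /eqP Eik.
  by case/eqP: ne_ki; apply/esym.
case: (b i); last by rewrite count_pred0.
rewrite (count_uniq_mem _ (iota_uniq _ _)) mem_iota /= add0n.
by rewrite (leq_trans (ltn_ord i)).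
Qed.

(** * Ring displacements and the routes *)

Definition moves (g : {perm V}) p := forall u, val (g u).2 = (u.2 + p) %% r.

Lemma moves1 : moves 1%g 0.
Proof. by move=> u; rewrite perm1 addn0 modn_small. Qed.

Lemma movesM g h p q : moves g p -> moves h q -> moves (g * h)%g (p + q).
Proof. by move=> gp hq u; rewrite permM hq gp modnDml addnA. Qed.

(** Displacements are naturals modulo r, and [r.-1] plays the part of -1. *)
Lemma movesV g p : moves g p -> moves g^-1%g (p * r.-1).
Proof.
move=> gp u; have := gp (g^-1%g u); rewrite permKV => ->.
rewrite modnDml -addnA -mulnS prednK; last by apply: leq_trans r_gt2.
by rewrite addnC modnMDl modn_small.
Qed.

Lemma movesX g p k : moves g p -> moves (g ^+ k)%g (k * p).
Proof.
move=> gp; elim: k => [|k IHk]; first exact: moves1.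
by rewrite expgS mulSn; apply: movesM.
Qed.

Lemma moves_ring : moves ring_perm 1.
Proof. by move=> u; rewrite permE /= addn1. Qed.

Lemma moves_sweep c m : moves (sweep c m) m.
Proof. by move=> u; rewrite sweepE val_iter_ordS. Qed.

(* Translation by the integer p - q: one of the truncated differences is 0. *)
Definition ring_shift p q : {perm V} :=
  (ring_perm ^+ (p - q) * ring_perm^-1 ^+ (q - p))%g.

Lemma moves_shift p q : moves (ring_shift p q) ((p - q) + (q - p) * r.-1).
Proof.
rewrite /ring_shift; apply: movesM.
  by rewrite -[X in moves _ X]muln1; apply/movesX/moves_ring.
apply: movesX; rewrite -[r.-1]mul1n; exact/movesV/moves_ring.
Qed.

(* A net displacement y of the ring is realised by a sweep of the m + 1
   positions following (or preceding) the start together with a direct walk;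
   the cheaper direction is taken. *)
Definition route m (c : bits) (y : nat) : {perm V} :=
  if (y - m) + (m - y) <= (r - y - m) + (m - (r - y))
  then (sweep (ext c) m * ring_shift y m)%g
  else ((sweep (ext c) m)^-1 * ring_shift m (r - y))%g.

(** A backward sweep that overshoots: -m + (m - (r - y)) is y modulo r, here with the multiple of r
    explicit. *)
Let route_arith m y x : 0 < r -> y < r -> r - y <= m ->
  x + (m * r.-1 + (m - (r - y) + (r - y - m) * r.-1)) = m.-1 * r + (x + y).
Proof.
case: (r) m => [|r'] [|m] //= _ lt_y le; first by lia.
by rewrite (_ : r'.+1 - y - m.+1 = 0); [nia | lia].
Qed.

Lemma moves_route m c y : y < r -> moves (route m c y) y.
Proof.
have r_gt0 : 0 < r by apply: leq_trans r_gt2.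
move=> lt_yr u; rewrite /route; case: ifP => _.
  rewrite (movesM (moves_sweep _ _) (moves_shift _ _)).
  have -> : u.2 + (m + (y - m + (m - y) * r.-1)) = (m - y) * r + (u.2 + y).
    by move: (val u.2) => x; nia.
  by rewrite modnMDl.
rewrite (movesM (movesV (moves_sweep _ _)) (moves_shift _ _)).
case: (leqP (r - y) m) => le.
  by rewrite route_arith // modnMDl.
have -> : u.2 + (m * r.-1 + (m - (r - y) + (r - y - m) * r.-1))
            = (r.-1 - y) * r + (u.2 + y).
  by move: (val u.2) => x; nia.
by rewrite modnMDl.
Qed.

(** The ring position of the image determines y, and y alone fixes the direction and the shift;
    cancelling the shift leaves the injectivity of sweeps. *)
Lemma route_bij m u : n <= d * m.+1 ->
  bijective (fun w : V => route m w.1 w.2 u).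
Proof.
move=> le_n; apply: injF_bij => -[c y] [c' y'] /= E.
have Ey : y = y'.
  apply/val_inj/eqP => /=; rewrite -(modn_small (ltn_ord y)) -(modn_small (ltn_ord y')).
  rewrite -(eqn_modDl u.2) -(moves_route m c (ltn_ord y) u).
  by rewrite -(moves_route m c' (ltn_ord y') u) E.
congr (_, _) => //; subst y'; move: E; rewrite /route; case: ifP => _.
  rewrite permM [RHS]permM => /perm_inj E.
  exact: (@sweep_inj m u le_n c c' E).
rewrite permM [RHS]permM => /perm_inj E.
(* Both inverse sweeps send [u] to the same point, and both sweeps bring that point back to [u]. *)
apply: (@sweep_inj m ((sweep (ext c) m)^-1%g u) le_n) => /=.
by rewrite permKV E permKV.
Qed.

(** * Lower bound for the cut of a bisection *)

Section LowerBound.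

Variable U : {set V}.

Lemma crossing_layer c t :
  crossing U (layer c t) <= \sum_(k < d) c (k + d * t) * crossing U (flip_perm k).
Proof.
rewrite (leq_trans (crossing_prod _ _ _ _)) // big_filter big_mkcond.
rewrite -[X in iota 0 X]subn0 -/(index_iota 0 d) big_mkord.
by apply: leq_sum => k _; case: ifP => _; rewrite ?mul1n.
Qed.

Lemma crossing_sweep c t :
  crossing U (sweep c t) <= t * crossing U ring_perm
    + \sum_(i < t.+1) \sum_(k < d) c (k + d * i) * crossing U (flip_perm k).
Proof.
elim: t => [|t IHt]; first by rewrite big_ord1 crossing_layer.
rewrite big_ord_recr /= (leq_trans (crossingM _ _ _)) // addnA.
apply: leq_add; last exact: crossing_layer.
by rewrite (leq_trans (crossingM _ _ _)) // mulSn -addnA addnC leq_add2l.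
Qed.

Lemma crossing_shift p q :
  crossing U (ring_shift p q) <= ((p - q) + (q - p)) * crossing U ring_perm.
Proof.
rewrite (leq_trans (crossingM _ _ _)) // mulnDl leq_add ?crossingX //.
by rewrite (leq_trans (crossingX _ _ _)) // crossingV.
Qed.

Lemma crossing_route m c y :
  crossing U (route m c y) <= ring_cost m r y * crossing U ring_perm
    + \sum_(i < m.+1) \sum_(k < d) ext c (k + d * i) * crossing U (flip_perm k).
Proof.
rewrite /ring_cost mulnDl addnAC; rewrite /route minnE.
case: ifP => le_c; rewrite (leq_trans (crossingM _ _ _)) // ?crossingV;
  rewrite leq_add ?crossing_sweep // (leq_trans (crossing_shift _ _)) //.
  by rewrite leq_mul2r; apply/orP; right; lia.
by rewrite leq_mul2r; apply/orP; right; lia.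
Qed.

(** A given relative index is selected by at most half of the [c], whence the factor 2 on the left;
    [r * m.+1] counts the pairs of a displacement and a layer. *)
Lemma sum_crossing_route m : n <= d * m.+1 ->
  2 * (#|U| * #|~: U|) <=
  2 ^ n * (2 * (\sum_(y < r) ring_cost m r y) * crossing U ring_perm
           + r * m.+1 * \sum_(k < d) crossing U (flip_perm k)).
Proof.
move=> le_n; rewrite -(sum_crossing U (fun u => route_bij u le_n)).
rewrite -(pair_bigA _ (fun c (y : 'I_r) => crossing U (route m c y))) /=.
have le_route : \sum_(c : bits) \sum_(y < r) crossing U (route m c y) <=
    \sum_(c : bits) \sum_(y < r) (ring_cost m r y * crossing U ring_perm
    + \sum_(i < m.+1) \sum_(k < d) ext c (k + d * i) * crossing U (flip_perm k)).
  by apply: leq_sum => c _; apply: leq_sum => y _; apply: crossing_route.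
rewrite (leq_trans (leq_mul (leqnn 2) le_route)) //.
pose Phi c := \sum_(i < m.+1) \sum_(k < d) ext c (k + d * i) * crossing U (flip_perm k).
have sum_pos c : \sum_(y < r) (ring_cost m r y * crossing U ring_perm + Phi c)
                 = (\sum_(y < r) ring_cost m r y) * crossing U ring_perm + r * Phi c.
  by rewrite big_split /= sum_nat_const card_ord big_distrl.
rewrite (eq_bigr _ (fun c _ => sum_pos c)) /Phi.
rewrite big_split /= sum_nat_const card_ffun card_bool card_ord !mulnDr.
apply: leq_add; first by rewrite mulnCA !mulnA.
rewrite -big_distrr exchange_big /=.
under eq_bigr => i _.
  rewrite exchange_big /=; under eq_bigr => k _ do rewrite -big_distrl /=.
  over.
have le_bit : \sum_(i < m.+1) \sum_(k < d)
      2 * ((\sum_(c : bits) ext c (k + d * i)) * crossing U (flip_perm k)) <=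
    \sum_(i < m.+1) \sum_(k < d) 2 ^ n * crossing U (flip_perm k).
  by apply: leq_sum => i _; apply: leq_sum => k _; rewrite mulnA leq_mul2r sum_ext orbT.
rewrite mulnCA -mulnA [2 ^ n * _]mulnCA leq_mul2l; apply/orP; right.
rewrite big_distrr /=; under eq_bigr => i _ do rewrite big_distrr /=.
apply: leq_trans le_bit _.
have -> : \sum_(i < m.+1) \sum_(k < d) 2 ^ n * crossing U (flip_perm k)
          = m.+1 * (2 ^ n * \sum_(k < d) crossing U (flip_perm k)).
  by rewrite sum_nat_const card_ord; congr (_ * _); rewrite big_distrr.
by rewrite mulnCA.
Qed.

(** The d flips and the two ring neighbours of a vertex are distinct, since d <= n and r > 2; both
    ring directions have the same crossing number. *)
Lemma crossing_le_cut :
  \sum_(k < d) crossing U (flip_perm k) + 2 * crossing U ring_perm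
  <= cut_size (@rcr_adj n d r) U.
Proof.
have r_gt0 : 0 < r by apply: leq_trans r_gt2.
pose s u := [seq flip_perm k u | k <- iota 0 d] ++ [:: ring_perm u; ring_perm^-1%g u].
have valS (x : 'I_r) : x.+1 %% r = if x.+1 == r then 0 else x.+1.
  case: eqVneq => [->|ne]; first exact: modnn.
  by rewrite modn_small // ltn_neqAle ne ltn_ord.
have valP' (x : 'I_r) : (x + r).-1 %% r = if x == 0 :> nat then r.-1 else x.-1.
  have := ltn_ord x; case: (val x) => [|k] lt_xr /=.
    by rewrite modn_small // prednK.
  by rewrite modnDr modn_small // ltnW.
have ringV u : (ring_perm^-1%g u) = (u.1, ord_pred u.2).
  apply: (@perm_inj _ ring_perm).
  by rewrite permKV permE /ring_step /= ord_predK; case: u.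
have uniq_s u : uniq (s u).
  have nin v : v.2 != u.2 -> v \notin [seq flip_perm k u | k <- iota 0 d].
    by move=> ne; apply/mapP => -[k _ Ev]; rewrite Ev permE eqxx in ne.
  rewrite cat_uniq; apply/and3P; split.
  - rewrite map_inj_in_uniq ?iota_uniq // => k l.
    rewrite !mem_iota !add0n => lt_k lt_l; rewrite !permE => E.
    have lt_j : (k + d * u.2) %% n < n by rewrite ltn_mod.
    have := congr1 (fun v : V => v.1 (Ordinal lt_j)) E.
    rewrite /= !flips1E eqxx => /addbI/esym /=.
    by rewrite eqn_modDr !modn_small ?(leq_trans _ le_dn) // => /eqP.
  - apply/hasPn => v; rewrite !inE => /orP[] /eqP -> /=; apply: nin.
      by rewrite permE -val_eqE /= valS; case: ifP; have := ltn_ord u.2; lia.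
    by rewrite ringV -val_eqE /= valP'; case: ifP; have := ltn_ord u.2; lia.
  rewrite /= inE andbT; apply/eqP => /(congr1 (fun v : V => val v.2)).
  rewrite permE ringV /= valS valP'.
  by have := ltn_ord u.2; case: ifP; case: ifP; lia.
have adj_s u v : v \in s u -> rcr_adj d u v.
  rewrite mem_cat => /orP[/mapP[k] | ].
    rewrite mem_iota add0n => /andP[_ lt_k] ->; rewrite permE /rcr_adj /= eqxx /=.
    apply/orP; left; apply/existsP; exists (Ordinal lt_k).
    by apply/forallP=> j; rewrite flips1E.
  rewrite !inE => /orP[] /eqP ->; rewrite /rcr_adj.
    by rewrite permE /= !eqxx addn1 eqxx orbT.
  rewrite ringV /= eqxx /= addn1.
  have E := congr1 val (ord_predK u.2). rewrite /= in E.
  by rewrite addn1 E eqxx !orbT.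
apply: leq_trans (cut_size_ge U uniq_s adj_s).
under [leqRHS]eq_bigr => u _.
  rewrite big_cat big_map /= !big_cons big_nil addn0.
  rewrite -[X in iota 0 X]subn0 -/(index_iota 0 d) big_mkord.
  over.
rewrite !big_split /= exchange_big /= -!/(crossing U _) crossingV.
by rewrite mul2n addnn.
Qed.

End LowerBound.

Lemma bit_cut_bisection (i : 'I_n) : is_bisection [set u : V | ~~ u.1 i].
Proof.
apply/half_is_bisection/(@swapped_card _ _ (fun u : V => (flips [:: val i] u.1, u.2))).
  by case=> a x [b y] [/(inv_inj (flips1K _)) -> ->].
by move=> u; rewrite !inE flips1E modn_small ?ltn_ord // eqxx addbT.
Qed.

Lemma Qbw_lower m K : n <= d * m.+1 ->
  4 * (\sum_(y < r) ring_cost m r y) <= K -> 4 * (r * m.+1) <= K ->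
  2 ^ n.+1 * r ^ 2 <= K * Qbw n d r.
Proof.
move=> le_n le_cost le_flip.
apply: leq_bisection_width (bit_cut_bisection (Ordinal n_gt0)) _ => U bU.
have cardV : #|V| = 2 ^ n * r by rewrite card_prod card_ffun card_bool !card_ord.
have evV : ~~ odd #|V| by rewrite cardV oddM oddX /= orbF eqn0Ngt n_gt0.
have := card_bisection_even evV bU; rewrite cardV => EU.
have := sum_crossing_route U le_n; have := crossing_le_cut U.
move: le_cost le_flip EU; rewrite expnMn (expnS 2 n).
set L := \sum_(y < r) _; set A := crossing U ring_perm; set B := \sum_(k < d) _.
set q := m.+1; set P := 2 ^ n; set C := cut_size _ _; set X := #|U| * _.
have P_gt0 : 0 < P by rewrite expn_gt0.
move=> le_cost le_flip EU le_cut le_X.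
rewrite -(leq_pmul2l P_gt0).
(* The vertex count P r is even, so both sides of the bisection have P r / 2 vertices. *)
have -> : P * (2 * P * r ^ 2) = 8 * X by transitivity (2 * (4 * X)); [rewrite EU|]; ring.
have le1 : 8 * X <= P * (4 * L * (2 * A) + 4 * (r * q) * B) by nia.
apply: leq_trans le1 _; rewrite leq_pmul2l //.
apply: (@leq_trans (K * (2 * A) + K * B)); last first.
  by rewrite -mulnDr leq_mul2l addnC le_cut orbT.
by rewrite leq_add // leq_mul2r ?le_cost ?le_flip orbT.
Qed.

End RecursiveCubeOfRings.

(** * Upper bounds from explicit bisections *)

Lemma cyclic_cut_ends r h x y : 0 < h < r -> x < r -> y < r -> x < h -> h <= y ->
  (y == (x + 1) %% r) || (x == (y + 1) %% r) ->
  if y == (x + 1) %% r then x.+1 = h /\ y = h else x = 0 /\ y = r.-1.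
Proof.
have succ_mod z : z < r -> (z + 1) %% r = if z + 1 == r then 0 else z + 1.
  move=> lt_z; case: eqVneq => [->|ne]; first exact: modnn.
  by rewrite modn_small //; lia.
move=> h_b x_b y_b xh hy; rewrite !succ_mod //.
by case: (x + 1 =P r) => ?; case: (y + 1 =P r) => ?; case: ifP; lia.
Qed.

Section UpperBounds.

Variables n d r : nat.
Hypotheses (n_gt0 : 0 < n) (r_gt2 : 2 < r).

Notation bits := {ffun 'I_n -> bool}.
Notation V := (rcr_vertex n r).

Lemma adj_bit (u v : V) (i : 'I_n) :
  rcr_adj d u v -> u.1 i != v.1 i ->
  v = (flips [:: val i] u.1, u.2) /\ exists k : 'I_d, (k + d * u.2) %% n = i.
Proof.
case: u v => [a x] [b y]; rewrite /rcr_adj /=.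
case/orP => /andP[/eqP E]; last by rewrite E eqxx.
case/existsP => k /forallP bE; rewrite (eqP (bE i)).
case: (eqVneq (val i)) => [Ei _ | _]; last by rewrite addbF eqxx.
split; last by exists k.
congr (_, _) => //; apply/ffunP => j.
by rewrite (eqP (bE j)) flips1E (modn_small (ltn_ord i)) Ei.
Qed.

(** The blocks [d x, d x + d) tile [0, dr), which contains dr/n multiples of n. Every position
    counted has such a multiple in its block. *)
Lemma card_hit_layers :
  n %| d * r -> #|[set x : 'I_r | [exists k : 'I_d, (k + d * x) %% n == 0]]| * n <= d * r.
Proof.
case/dvdnP => Q EQ; rewrite EQ leq_mul2r; apply/orP; right.
rewrite -[leqRHS]card_ord.
have r_gt0 : 0 < r by apply: leq_trans r_gt2.
(* Position of the block containing n s; the default 0 only makes the map total. *)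
pose f (s : 'I_Q) : 'I_r := insubd (Ordinal r_gt0) (n * s %/ d).
apply: leq_trans (leq_imset_card f predT); apply: subset_leq_card.
apply/subsetP => x; rewrite inE => /existsP[k /dvdnP[s Es]].
have d_gt0 : 0 < d by apply: leq_ltn_trans (ltn_ord k).
have lt_sQ : s < Q.
  by rewrite -(ltn_pmul2r n_gt0) -EQ -Es; have := ltn_ord k; have := ltn_ord x; nia.
apply/imsetP; exists (Ordinal lt_sQ) => //; apply/val_inj.
have Ex : n * s %/ d = x.
  by rewrite mulnC -Es addnC mulnC divnMDl // divn_small ?addn0.
by rewrite /f /= val_insubd Ex ltn_ord.
Qed.

(** Split by bit 0. A cut edge is determined by its end in the set, which has 2^(n-1) possible bit
    vectors and at most dr/n possible positions. *)
Lemma Qbw_bit_cut : n %| d * r -> Qbw n d r * (2 * n) <= 2 ^ n * (d * r).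
Proof.
move=> n_dvd; pose i0 := Ordinal n_gt0.
have := bisection_width_le (@rcr_adj n d r) (bit_cut_bisection r i0).
rewrite -/(Qbw n d r) => le_cut.
set B := [set x : 'I_r | [exists k : 'I_d, (k + d * x) %% n == 0]].
pose A := [set a : bits | ~~ a i0].
have le_AB : cut_size (@rcr_adj n d r) [set u : V | ~~ u.1 i0] <= #|A| * #|B|.
  rewrite -cardsX /cut_size; set X := [set p : V * V | _].
  have cutP p : p \in X -> p.2 = (flips [:: val i0] p.1.1, p.1.2) /\ p.1 \in setX A B.
    rewrite !inE negbK => /andP[/andP[u0 v0] uv].
    have [] := adj_bit (i := i0) uv; first by rewrite v0 (negbTE u0).
    move=> -> [k Ek]; split=> //; rewrite u0; apply/existsP; exists k.
    exact/eqP.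
  rewrite -(@card_in_imset _ _ (fun p => p.1) X); last first.
    move=> [u v] [u' v'] /cutP[/= -> _] /cutP[/= -> _] /=.
    by move=> ->.
  by apply: subset_leq_card; apply/subsetP=> _ /imsetP[p /cutP[_ pAB] ->].
have := card_bit_false i0; have := card_hit_layers n_dvd; rewrite -/A -/B.
nia.
Qed.

(** In each column [a] the set is an arc with two boundary edges. The arc length depends on [a j]
    only for odd r, so flip edges are cut only in the middle layer and only along bit [j]. *)
Lemma Qbw_ring_cut (j : 'I_n) :
  Qbw n d r <= 2 ^ n * 2
    + (odd r && [exists k : 'I_d, (k + d * r./2) %% n == j]) * 2 ^ n.-1.
Proof.
pose h (a : bits) := r./2 + (odd r && ~~ a j).
pose U := [set u : V | u.2 < h u.1].
have r_half := odd_double_half r.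
have h_lt a : 0 < h a < r.
  by rewrite /h; case: (odd r) r_half; case: (a j) => /=; lia.
have bU : is_bisection U.
  apply/half_is_bisection.
  (* Flipping bit [j] turns the arc length h into r - h when r is odd; for even r, h = r/2. *)
  apply: (@swapped_card _ _ (fun u : V => (flips [:: val j] u.1, rev_ord u.2))).
    move=> [a x] [b y] E; congr (_, _).
      exact: inv_inj (flips1K _) _ _ (congr1 fst E).
    exact: rev_ord_inj (congr1 snd E).
  move=> [a x]; rewrite !inE /h flips1E modn_small ?ltn_ord // eqxx addbT negbK /=.
  by have := ltn_ord x; case: (odd r) r_half; case: (a j) => /=; lia.
apply: leq_trans (bisection_width_le _ bU) _.
rewrite /cut_size; set X := [set p : V * V | _].
pose P := [set p : V * V | p.1.1 == p.2.1].
rewrite -(cardsID P X); apply: leq_add.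
  (* A cut ring edge is encoded by its column and by which end of the arc it leaves. *)
  pose phi (p : V * V) := (p.1.1, p.2.2 == (p.1.2 + 1) %% r :> nat).
  have ends (a b : bits) (x y : 'I_r) : ((a, x), (b, y)) \in X :&: P ->
      b = a /\ if y == (x + 1) %% r :> nat then x.+1 = h a /\ y = h a :> nat
               else x = 0 :> nat /\ y = r.-1 :> nat.
    rewrite !inE /= => /andP[/andP[/andP[xU yU] xy] /eqP Eab]; subst b.
    split=> //; have := ltn_ord x; have := ltn_ord y; have := h_lt a.
    move: xy; rewrite /rcr_adj /= eqxx /= => /orP[/andP[/eqP E] | ].
      by move: yU; rewrite -E xU.
    move=> xy h_a lt_y lt_x; apply: cyclic_cut_ends => //.
    by rewrite leqNgt.
  have phi_inj : {in X :&: P &, injective phi}.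
    move=> [[a x] [b y]] [[a' x'] [b' y']] /ends[-> E] /ends[-> E'] [Ea Ey].
    subst a'; move: E E'; rewrite /= in Ey; rewrite Ey.
    by case: ifP => _ [Ex1 Ey1] [Ex2 Ey2]; congr (_, _, (_, _)); apply/val_inj => /=; lia.
  rewrite -(card_in_imset phi_inj) (leq_trans (max_card _)) //.
  by rewrite card_prod card_ffun !card_bool card_ord.
have cutP p : p \in X :\: P ->
    [/\ p.2 = (flips [:: val j] p.1.1, p.1.2), p.1.2 = r./2 :> nat, ~~ p.1.1 j
      & odd r && [exists k : 'I_d, (k + d * r./2) %% n == j]].
  case: p => [[a x] [b y]]; rewrite !inE /= => /andP[ne_ab /andP[/andP[xU yU] xy]].
  have Exy : x = y.
    by move: xy; rewrite /rcr_adj /= (negbTE ne_ab) orbF => /andP[/eqP].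
  subst y; move: xU yU; rewrite /h -leqNgt.
  case: (boolP (odd r)) => odd_r; last by rewrite !addn0 ltnNge => /negbTE ->.
  case: (boolP (a j)) => aj; case: (boolP (b j)) => bj /= xU yU; try lia.
  have [|Eb [k Ek]] := adj_bit (i := j) xy; first by rewrite /= (negbTE aj) bj.
  have Ex : x = r./2 :> nat by lia.
  by split=> //; apply/existsP; exists k; rewrite -Ex; apply/eqP.
have [-> | [p0 /cutP[_ _ _ ->]]] := set_0Vmem (X :\: P); first by rewrite cards0.
have pow_n : 2 ^ n = 2 ^ n.-1 * 2 by rewrite -expnSr prednK.
have := card_bit_false j; rewrite pow_n => /eqP.
rewrite eqn_pmul2r // mul1n => /eqP <-.
rewrite -(@card_in_imset _ _ (fun p => p.1.1) (X :\: P)); last first.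
  move=> [[a x] v] [[a' x'] v'] /cutP[/= -> Ex _ _] /cutP[/= -> Ex' _ _] /= ->.
  by have -> : x = x' by apply/val_inj; rewrite /= Ex Ex'.
apply: subset_leq_card; apply/subsetP=> _ /imsetP[p /cutP[_ _ pj _] ->].
by rewrite inE.
Qed.

Lemma Qbw_le_ring : Qbw n d r <= 5 * 2 ^ n.-1.
Proof.
apply: leq_trans (Qbw_ring_cut (Ordinal n_gt0)) _.
by rewrite -{1}(prednK n_gt0) expnS; case: (_ && _); lia.
Qed.

Lemma Qbw_le_ring_even : ~~ odd r || (d < n) -> Qbw n d r <= 2 ^ n * 2.
Proof.
(* The first bit after the block flipped in the middle layer; it lies outside that block when d <
   n. *)
move=> cond; have lt_j : (d + d * r./2) %% n < n by rewrite ltn_mod.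
apply: leq_trans (Qbw_ring_cut (Ordinal lt_j)) _.
case: (boolP (odd r)) cond => [_ /= lt_dn | _ _]; last by rewrite mul0n addn0.
case: existsP => [[k] | _]; last by rewrite mul0n addn0.
rewrite eqn_modDr !modn_small // ?(ltn_trans (ltn_ord k)) //.
by rewrite ltn_eqF.
Qed.

End UpperBounds.

(** * The lower bound for q = ceil(n/d) and for q = r *)

Lemma ceil_div_ge n d : 0 < d -> n <= d * ceil_div n d.
Proof.
move=> d_gt0; rewrite /ceil_div.
have := divn_eq (n + d.-1) d; have := ltn_pmod (n + d.-1) d_gt0.
by rewrite mulnC; lia.
Qed.

Lemma ceil_div_dvd n d : 0 < d -> d %| n -> ceil_div n d = n %/ d.
Proof.
move=> d_gt0 /dvdnP[q ->]; rewrite /ceil_div mulnK // divnMDl //.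
by rewrite divn_small ?addn0 // prednK.
Qed.

Lemma Qbw_lower_ceil n d r : 0 < n -> 0 < d -> d <= n -> 2 < r -> n %| d * r ->
  2 ^ n.+1 * r ^ 2 <= (r ^ 2 + 8 * ceil_div n d ^ 2) * Qbw n d r.
Proof.
move=> n_gt0 d_gt0 le_dn r_gt2 n_dvd; have := ceil_div_ge n d_gt0.
case: (ceil_div n d) => [|m] le_n; first by rewrite muln0 leqNgt n_gt0 in le_n.
apply: (Qbw_lower n_gt0 le_dn r_gt2 n_dvd le_n).
  by rewrite (leq_trans (sum_ring_cost m r)) // leq_add2l leq_mul2l
             leq_exp2r ?leqnSn ?orbT.
by nia.
Qed.

(** When dr = n, the sweep must visit all r positions to reach every bit, so m = r - 1. *)
Lemma Qbw_lower_full n d r K : 0 < n -> d <= n -> 2 < r -> d * r = n ->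
  4 * r ^ 2 <= K -> 5 * r ^ 2 <= K + 8 * r.-1 ->
  2 ^ n.+1 * r ^ 2 <= K * Qbw n d r.
Proof.
move=> n_gt0 le_dn r_gt2 drn le1 le2; have Er : r.-1.+1 = r by case: (r) r_gt2.
apply: (@Qbw_lower n d r n_gt0 le_dn r_gt2 _ r.-1); rewrite ?Er ?drn ?mulnn //.
by have := sum_ring_cost_full r.-1; rewrite Er; lia.
Qed.

(** * The bounds over the rationals, case by case *)

Local Open Scope ring_scope.

Theorem mainTheorem19 (n d r : nat) :
  (2 <= n)%N -> (1 <= d)%N -> (3 <= r)%N -> (d <= n)%N -> (d * r %% n = 0)%N ->
  let bw : rat := (Qbw n d r)%:R in
  let q : nat := ceil_div n d in
  ((d * r = n)%N ->
     ((r <= 6)%N -> bw = (2 ^ n.-1)%:R) /\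
     ((7 <= r)%N ->
        (2 ^ n.+1)%:R / (5 - 8 * (r%:R - 1) / (r%:R ^+ 2)) <= bw
        /\ bw <= (2 ^ n.-1)%:R)) /\
  ((2 * n <= d * r)%N ->
     ((d %| n)%N -> (~~ odd r || (2 * d <= n)%N) ->
        (2 ^ n.+1)%:R * r%:R ^+ 2 / (r%:R ^+ 2 + 8 * n%:R ^+ 2 / d%:R ^+ 2) <= bw
        /\ bw <= (2 ^ n)%:R * Num.min ((d * r)%:R / (2 * n)%:R) 2) /\
     (odd r -> n = d ->
        (2 ^ n.+1)%:R * r%:R ^+ 2 / (r%:R ^+ 2 + 8) <= bw
        /\ bw <= (2 ^ n.-1)%:R * Num.min r%:R 5) /\
     (~~ (d %| n)%N ->
        (2 ^ n)%:R * Num.min ((d * r)%:R / (4 * n + 2 * d)%:R)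
                             (2 * r%:R ^+ 2 / (r%:R ^+ 2 + 8 * q%:R ^+ 2)) <= bw
        /\ bw <= (2 ^ n)%:R * Num.min ((d * r)%:R / (2 * n)%:R) 2)).
Proof.
move=> n_gt1 d_gt0 r_gt2 le_dn dr0 bw q.
have n_gt0 : (0 < n)%N by apply: ltnW.
have r_gt0 : (0 < r)%N by apply: leq_trans r_gt2.
have n_dvd : (n %| d * r)%N by apply/eqP.
have pow_n : (2 ^ n = 2 * 2 ^ n.-1)%N by rewrite -expnS prednK.
have rR0 : 0 < r%:R :> rat by rewrite ltr0n.
have r2R0 : 0 < r%:R ^+ 2 :> rat by rewrite exprn_gt0.
have bit := Qbw_bit_cut n_gt0 r_gt2 n_dvd.
have upper : (~~ odd r || (d < n)%N) ->
    bw <= (2 ^ n)%:R * Num.min ((d * r)%:R / (2 * n)%:R) 2.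
  move=> cond; rewrite minr_pMr ?ler0n // le_min; apply/andP; split.
    by rewrite mulrA ler_pdivlMr ?ltr0n ?muln_gt0 // -!natrM ler_nat.
  by rewrite -natrM ler_nat Qbw_le_ring_even.
have lower : (2 ^ n.+1)%:R * r%:R ^+ 2 / (r%:R ^+ 2 + 8 * q%:R ^+ 2) <= bw.
  rewrite ler_pdivrMr; last by rewrite ltr_wpDr // mulr_ge0 ?exprn_ge0 ?ler0n.
  have := Qbw_lower_ceil n_gt0 d_gt0 le_dn r_gt2 n_dvd.
  by rewrite -(ler_nat rat) !natrM natrD natrM !natrX [X in _ <= X]mulrC.
split=> [drn | le_2n].
  have upper_a : (Qbw n d r <= 2 ^ n.-1)%N.
    by move: bit; rewrite drn pow_n; nia.
  split=> [r_le6 | r_ge7].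
    apply/eqP; rewrite /bw eqr_nat eqn_leq upper_a /=.
    (* For 3 <= r <= 6 one has r^2 <= 8(r - 1), so K = 4 r^2 is admissible and matches the upper
       bound. *)
    have := @Qbw_lower_full n d r (4 * r ^ 2) n_gt0 le_dn r_gt2 drn (leqnn _).
    rewrite (expnS 2 n) pow_n => lo.
    have /lo : (5 * r ^ 2 <= 4 * r ^ 2 + 8 * r.-1)%N by nia.
    have : (0 < r ^ 2)%N by rewrite expn_gt0 r_gt0.
    by move: (r ^ 2)%N => r2; nia.
  split; last by rewrite ler_nat.
  (* From r = 7 on, 8(r - 1) <= r^2, and K = 5 r^2 - 8(r - 1) is at least 4 r^2. *)
  have le_K : (8 * r.-1 + 4 * r ^ 2 <= 5 * r ^ 2)%N by nia.
  have := @Qbw_lower_full n d r (5 * r ^ 2 - 8 * r.-1) n_gt0 le_dn r_gt2 drn.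
  have -> : (5 * r ^ 2 <= 5 * r ^ 2 - 8 * r.-1 + 8 * r.-1)%N by lia.
  have -> : (4 * r ^ 2 <= 5 * r ^ 2 - 8 * r.-1)%N by lia.
  move=> /(_ isT isT) lo.
  have K_gt0 : (0 < 5 * r ^ 2 - 8 * r.-1)%N by nia.
  have EK : (5 * r ^ 2 - 8 * r.-1)%:R = 5 * r%:R ^+ 2 - 8 * (r%:R - 1) :> rat.
    by rewrite natrB; [rewrite (natrM _ 5) (natrM _ 8) natrX -subn1 natrB | lia].
  move: K_gt0; rewrite -(ltr0n rat) EK => K_gt0.
  have -> : 5 - 8 * (r%:R - 1) / r%:R ^+ 2
            = (5 * r%:R ^+ 2 - 8 * (r%:R - 1)) / r%:R ^+ 2 :> rat.
    by field; rewrite lt0r_neq0.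
  by rewrite invf_div mulrA ler_pdivrMr // -EK -natrX -!natrM ler_nat [leqRHS]mulnC.
split=> [dvd_dn cond | ].
  have Eq : n%:R = q%:R * d%:R :> rat.
    by rewrite /q ceil_div_dvd // -natrM divnK.
  have dR0 : d%:R != 0 :> rat by rewrite pnatr_eq0 -lt0n.
  split; last by apply: upper; case/orP: cond => [-> //|?]; apply/orP; right; lia.
  suff -> : 8 * n%:R ^+ 2 / d%:R ^+ 2 = 8 * q%:R ^+ 2 :> rat by [].
  by rewrite Eq; field.
split=> [odd_r End | ndvd].
  split.
    suff Eq : q = 1%N by move: lower; rewrite Eq expr1n mulr1.
    by rewrite /q ceil_div_dvd // End // divnn d_gt0.
  (* The bit cut gives the factor r, the cut into two arcs the factor 5. *)
  rewrite minr_pMr ?ler0n // le_min -!natrM !ler_nat; apply/andP; split.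
    by move: bit; rewrite -End pow_n; nia.
  by rewrite mulnC Qbw_le_ring.
have lt_dn : (d < n)%N.
  by rewrite ltn_neqAle le_dn andbT; apply: contraNneq ndvd => ->.
split; last by apply: upper; rewrite lt_dn orbT.
apply: le_trans lower; rewrite expnSr (natrM _ (2 ^ n)) -!mulrA.
rewrite ler_pM2l ?ltr0n ?expn_gt0 //.
by rewrite ge_min lexx orbT.
Qed.
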